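(* Let $S$ be a set, let $\mathcal{A}\subseteq\mathcal{P}(S)$ be an adequate family, and let $\mathcal{K}_{\mathcal{A}}$ be the corresponding adequate compact. Then $\mathcal{C}(\mathcal{K}_{\mathcal{A}})$ has a $1$-norming Markuševič basis.
   Context: A family $\mathcal{A}\subseteq\mathcal{P}(S)$ is adequate if: (i) $\{x\}\in\mathcal{A}$ for each $x\in S$; (ii) if $A\in\mathcal{A}$ and $B\subseteq A$, then $B\in\mathcal{A}$; (iii) if $B\subseteq S$ is such that all finite subsets of $B$ belong to $\mathcal{A}$, then $B\in\mathcal{A}$. The power set $\mathcal{P}(S)$ is identified with $\{0,1\}^S$ via $A\leftrightarrow 1_A$, with the product topology; every adequate family is closed in $\mathcal{P}(S)$, and $\mathcal{K}_{\mathcal{A}}$ denotes $\mathcal{A}$ viewed as a compact space with the subspace topology. $\mathcal{C}(\mathcal{K})$ is the Banach space of continuous scalar-valued (real or complex) functions on $\mathcal{K}$ with the supremum norm. A biorthogonal system in a Banach space $\mathcal{X}$ is a system $\{x_\gamma;\varphi_\gamma\}_{\gamma\in\Gamma}$ with $x_\gamma\in\mathcal{X}$, $\varphi_\gamma\in\mathcal{X}^*$ and $\langle\varphi_\alpha,x_\beta\rangle=\delta_{\alpha,\beta}$ for all $\alpha,\beta\in\Gamma$. It is a Markuševič basis (M-basis) if $\mathrm{span}\{x_\gamma\}_{\gamma\in\Gamma}$ is norm-dense in $\mathcal{X}$ and $\mathrm{span}\{\varphi_\gamma\}_{\gamma\in\Gamma}$ is $w^*$-dense in $\mathcal{X}^*$.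 An M-basis is $1$-norming if $$\|x\|\leq\sup\{|\langle\varphi,x\rangle|\colon \varphi\in\mathrm{span}\{\varphi_\gamma\}_{\gamma\in\Gamma},\ \|\varphi\|\leq 1\}\qquad\text{for all }x\in\mathcal{X}.$$ *)

(* Defs.v *)
From HB Require Import structures.
From mathcomp Require Import all_boot all_order all_algebra.
From mathcomp Require Import all_classical all_reals all_analysis.
From mathcomp Require Import complex.

Set Implicit Arguments.
Unset Strict Implicit.
Unset Printing Implicit Defensive.

Import Order.TTheory GRing.Theory Num.Theory.
Import numFieldNormedType.Exports.

Local Open Scope classical_set_scope.
Local Open Scope ring_scope.

Variant scalar_kind := RealScalars | ComplexScalars.

Definition scalar_field (R : realType) (k : scalar_kind) : numFieldType :=
  match k with
  | RealScalars => R
  | ComplexScalars => R[i]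
  end.

(* Norms take values in the field of scalars, hence so do the suprema below. Over
   [R[i]], [supremum 0] refers to the partial order of [R[i]]: a complex upper
   bound of a nonempty set of reals is real, so this is the usual supremum. On
   the empty set and on sets without supremum the value is [0]; on the sets of
   moduli used below the latter does not occur over [R] and [R[i]]. *)
Lemma scalar_supremums (R : realType) (k : scalar_kind) (E : set (scalar_field R k)) :
  (forall e, E e -> 0 <= e) -> has_sup E -> supremums E (supremum 0 E).
Proof.
move=> E0 [[e0 Ee0] [M ubM]].
suff [s Es] : supremums E !=set0.
  rewrite /supremum; case: ifPn => [/eqP E_0|_]; first by rewrite E_0 in Ee0.
  by case: xgetP => // /(_ s).
case: k E E0 e0 Ee0 M ubM => /= E E0 e0 Ee0 M ubM.
  exists (sup E); split.
    by apply/ubP => e Ee; apply: ub_le_sup => //; exists M.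
  by move=> y uby; apply: ge_sup => //; exists e0.
have reE e : E e -> e = (complex.Re e)%:C%C.
  by move=> /E0; case: e => a b; rewrite lecE /= => /andP[/eqP -> _].
pose F := [set complex.Re e | e in E].
have leF e y : E e -> e <= y -> complex.Re e <= complex.Re y.
  by move=> _; rewrite lecE => /andP[].
have F0 : F !=set0 by exists (complex.Re e0), e0.
exists (sup F)%:C%C; split.
  move=> e Ee; rewrite (reE _ Ee) lecR; apply: ub_le_sup; last by exists e.
  by exists (complex.Re M) => _ [e' Ee' <-]; apply: leF => //; exact: ubM.
move=> y uby.
have y0 : 0 <= y by apply: le_trans (E0 _ Ee0) (uby _ Ee0).
have -> : y = (complex.Re y)%:C%C.
  by move: y0 {uby}; case: y => a b; rewrite lecE /= => /andP[/eqP -> _].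
rewrite lecR; apply: ge_sup => // _ [e Ee <-].
by apply: leF => //; exact: uby.
Qed.

HB.mixin Record isCompactSpace X of Topological X := {
  compact_space : compact [set: X]
}.

#[short(type="compactSpaceType")]
HB.structure Definition CompactSpace :=
  {X of Topological X & isCompactSpace X}.

Section continuous_functions.
Context (R : realType) (k : scalar_kind) (X : compactSpaceType).
Local Notation K := (scalar_field R k).

Definition cts_pred : {pred X -> K^o} := mem [set f : X -> K^o | continuous f].

Definition cfun := continuousType X K^o.

HB.instance Definition _ := Choice.on cfun.

Definition cfun_Sub (f : X -> K^o) (Pf : f \in cts_pred) : cfun :=
  mkcts (set_mem Pf : continuous f).

Lemma cfun_rect (P : cfun -> Type) :
  (forall f (Pf : f \in cts_pred), P (cfun_Sub Pf)) -> forall u, P u.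
Proof.
move=> Psub f; have Pf : (f : X -> K^o) \in cts_pred.
  by rewrite inE; exact: cts_fun.
suff -> : f = cfun_Sub Pf by [].
exact/continuousEP.
Qed.

Lemma cfun_valP f (Pf : f \in cts_pred) : cfun_Sub Pf = f :> (X -> K^o).
Proof. by []. Qed.

HB.instance Definition _ := isSub.Build _ _ cfun cfun_rect cfun_valP.

Lemma cts_submod_closed : submod_closed cts_pred.
Proof.
split=> [|a f g]; rewrite !inE /=; first by move=> x; exact: cvg_cst.
move=> cf cg x; apply: continuousD; last exact: cg.
by apply: (@continuousZl_tmp _ K^o); exact: cf.
Qed.

HB.instance Definition _ :=
  GRing.isSubmodClosed.Build K (X -> K^o) cts_pred cts_submod_closed.

HB.instance Definition _ := [SubChoice_isSubLmodule of cfun by <:].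

Definition sup_norm (f : cfun) : K :=
  supremum 0 (range (fun x : X => `|f x|)).

Lemma cfun_bounded (f : cfun) : has_ubound (range (fun x : X => `|f x|)).
Proof.
have : \forall M \near +oo, [set: X] `<=` [set x | `|f x| <= M].
  have /compact_near_coveringP := @compact_space X.
  apply => x _.
  have /cvgrPdist_le/(_ 1 ltr01) fx : f @ x --> f x by exact: cts_fun.
  near=> y M => /=.
  have -> : f y = f x - (f x - f y) by rewrite opprB addrC subrK.
  apply: le_trans (ler_normB _ _) _.
  apply: (@le_trans _ _ (`|f x| + 1)); first by rewrite lerD2l; near: y.
  by near: M; apply: nbhs_pinfty_ge; rewrite rpredD ?normr_real ?real1.
move=> /pinfty_ex_gt0[M _ fM]; exists M => _ [x _ <-]; exact: fM.
Unshelve. all: by end_near. Qed.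

Lemma sup_norm_supremums (f : cfun) (x : X) :
  supremums (range (fun x : X => `|f x|)) (sup_norm f).
Proof.
apply: scalar_supremums; first by move=> _ [y _ <-].
by split; [exists `|f x|, x | exact: cfun_bounded].
Qed.

Lemma sup_norm_empty (f : cfun) : ~ (exists x : X, True) -> sup_norm f = 0.
Proof.
move=> X0; rewrite /sup_norm; set E := (E in supremum 0 E).
suff -> : E = set0 by rewrite supremum0.
by apply/seteqP; split=> // y [x _ _]; case: X0; exists x.
Qed.

Lemma le_sup_norm (f : cfun) (x : X) : `|f x| <= sup_norm f.
Proof. by have [+ _] := sup_norm_supremums f x; apply; exists x. Qed.

Lemma sup_norm_le (f : cfun) (M : K) :
  0 <= M -> (forall x, `|f x| <= M) -> sup_norm f <= M.
Proof.
move=> M0 fM; have [[x _]|X0] := pselect (exists x : X, True).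
  by have [_ +] := sup_norm_supremums f x; apply=> _ [y _ <-].
by rewrite sup_norm_empty.
Qed.

Lemma sup_norm_ge0 (f : cfun) : 0 <= sup_norm f.
Proof.
have [[x _]|X0] := pselect (exists x : X, True).
  exact: le_trans (le_sup_norm f x).
by rewrite sup_norm_empty.
Qed.

Lemma sup_normD (f g : cfun) : sup_norm (f + g) <= sup_norm f + sup_norm g.
Proof.
apply: sup_norm_le => [|x]; first by rewrite addr_ge0 ?sup_norm_ge0.
exact: le_trans (ler_normD _ _) (lerD (le_sup_norm f x) (le_sup_norm g x)).
Qed.

Lemma sup_normZ (a : K) (f : cfun) : sup_norm (a *: f) = `|a| * sup_norm f.
Proof.
have leZ b (g : cfun) : sup_norm (b *: g) <= `|b| * sup_norm g.
  apply: sup_norm_le => [|x]; first by rewrite mulr_ge0 ?sup_norm_ge0.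
  by rewrite normrZ ler_wpM2l// le_sup_norm.
have [->|a0] := eqVneq a 0.
  apply/eqP; rewrite normr0 mul0r eq_le sup_norm_ge0 andbT.
  by have := leZ 0 f; rewrite normr0 mul0r.
apply/eqP; rewrite eq_le leZ/= -ler_pdivlMl ?normr_gt0// -normfV.
by have := leZ a^-1 (a *: f); rewrite scalerA mulVf// scale1r.
Qed.

Lemma sup_norm_eq0 (f : cfun) : sup_norm f = 0 -> f = 0.
Proof.
move=> f0; apply/continuousEP => x; apply/eqP.
by rewrite -normr_le0 -f0 le_sup_norm.
Qed.

HB.instance Definition _ :=
  Lmodule_isNormed.Build K cfun sup_normD sup_normZ sup_norm_eq0.

End continuous_functions.

Definition lspan (K : pzRingType) (V : lmodType K) (I : Type) (v : I -> V) :
    set V :=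
  [set u | exists (n : nat) (a : 'I_n -> K) (i : 'I_n -> I),
     u = \sum_(j < n) a j *: v (i j)].

Section dual.
Context (K : numFieldType) (X : normedModType K).

Definition dual_pred : {pred X -> K^o} :=
  mem [set phi : X -> K^o | linear phi /\ continuous phi].

Record dual : Type := Dual {
  dual_fun :> X -> K^o;
  _ : dual_fun \in dual_pred
}.

HB.instance Definition _ := [isSub for dual_fun].
HB.instance Definition _ := [Choice of dual by <:].

Lemma dual_submod_closed : submod_closed dual_pred.
Proof.
split=> [|a f g]; rewrite !inE /=.
  split=> [b u v|x]; last exact: cvg_cst.
  by have -> : (0 : X -> K^o) = cst 0 by []; rewrite /= scaler0 addr0.
move=> [lf cf] [lg cg]; split=> [b u v|x].
  have E z : (a *: f + g) z = a *: f z + g z by [].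
  rewrite !E lf lg !scalerDr !scalerA (mulrC a b) -!addrA.
  by congr (_ + _); rewrite addrCA.
apply: continuousD; last exact: cg.
by apply: (@continuousZl_tmp _ K^o); exact: cf.
Qed.

HB.instance Definition _ :=
  GRing.isSubmodClosed.Build K (X -> K^o) dual_pred dual_submod_closed.

HB.instance Definition _ := [SubChoice_isSubLmodule of dual by <:].

Definition dual_norm (phi : dual) : K :=
  supremum 0 [set `|phi x| | x in [set x | `|x| <= 1]].

Definition weak_star : Type :=
  initial_topology (dual_fun : dual -> {ptws X -> K^o}).

HB.instance Definition _ := Topological.on weak_star.

End dual.

Section markushevich.
Context (K : numFieldType) (X : normedModType K) (Gamma : choiceType).
Context (x : Gamma -> X) (phi : Gamma -> dual X).

Definition biorthogonal : Prop :=
  forall a b, phi a (x b) = (a == b)%:R.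

Definition markushevich_basis : Prop :=
  [/\ biorthogonal, dense (lspan x) & dense (lspan phi : set (weak_star X))].

Definition one_norming : Prop :=
  forall u : X,
    `|u| <= supremum 0
      [set `|psi u| | psi in lspan phi `&` [set psi | dual_norm psi <= 1]].

End markushevich.

Record adequate (S : Type) (A : set (set S)) : Prop := Adequate {
  adequate1 : forall x, A [set x];
  adequateS : forall B C, A B -> C `<=` B -> A C;
  adequate_fin : forall B,
    (forall F, finite_set F -> F `<=` B -> A F) -> A B
}.

Section adequate_compact.
Context (S : Type) (A : set (set S)).

(* [set S] is identified with [{ptws S -> bool}] (with [bool] discrete) through
   indicator functions. *)
Definition adequate_indic : set {ptws S -> bool} :=
  [set f | A [set x | f x]].

Lemma adequate_indic_closed : adequate A -> closed adequate_indic.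
Proof.
move=> hA f clf; apply: (adequate_fin hA) => F finF Ff.
have : nbhs f [set g : {ptws S -> bool} | F `<=` [set x | g x]].
  have [s sF] : exists s : seq {classic S}, F = [set` s].
    by have /finite_seqP[s ->] : finite_set (F : set {classic S}) := finF; exists s.
  rewrite sF in Ff *; elim: s Ff {sF} => [|y s IHs] sf.
    by apply: filterE => g z; rewrite /= in_nil.
  have sy : nbhs f [set g : {ptws S -> bool} | g y].
    have fy : f y by apply: sf; rewrite /= mem_head.
    have by0 : nbhs (f y) [set b : bool | b] by apply/principal_filterP.
    exact: (@proj_continuous {classic S} (fun=> bool) y f _ by0).
  have ss : nbhs f [set g : {ptws S -> bool} | [set` s] `<=` [set x | g x]].
    by apply: IHs => z zs; apply: sf; rewrite /= in_cons orbC [z \in s]zs.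
  apply: filterS2 sy ss => g gy gs z; rewrite /= in_cons => /predU1P[->//|].
  exact: gs.
move=> /clf[g [Ag Fg]]; exact: adequateS Ag Fg.
Qed.

Definition adequate_compact (hA : adequate A) : Type := adequate_indic.

Context (hA : adequate A).

HB.instance Definition _ := Topological.on (adequate_compact hA).

Lemma adequate_compact_subproof : compact [set: adequate_compact hA].
Proof.
have cA : compact adequate_indic.
  apply: (@subclosed_compact _ adequate_indic [set f | forall x, [set: bool] (f x)]).
  - exact: adequate_indic_closed.
  - exact: (@tychonoff {classic S} (fun=> bool) (fun=> setT) (fun=> bool_compact)).
  - by [].
move=> F FF _; pose G := (set_val : adequate_indic -> {ptws S -> bool}) @ F.
have GA : G adequate_indic by apply: (@filterE _ F) => x; exact: set_valP.
have [p [Ap Gp]] := cA G _ GA.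
exists (SigSub (mem_set Ap)); split=> // U V FU.
move=> [_ [[W oW <-] Wp] sWV].
have GU : G (set_val @` U) by apply: (@filterS _ F _ U) FU => u Uu; exists u.
have [_ [[u Uu <-] Wu]] := Gp _ _ GU (open_nbhs_nbhs (conj oW Wp)).
by exists u; split=> //; exact: sWV.
Qed.

HB.instance Definition _ :=
  isCompactSpace.Build (adequate_compact hA) adequate_compact_subproof.

End adequate_compact.

(* Main.v *)
From HB Require Import structures.
Require Import Defs.
From mathcomp Require Import all_boot all_order all_algebra.
From mathcomp Require Import all_classical all_reals all_analysis.
From mathcomp Require Import finmap ring.
From mathcomp Require Import showcase.summability.

Set Implicit Arguments.
Unset Strict Implicit.
Unset Printing Implicit Defensive.

Import Order.TTheory GRing.Theory Num.Theory.
Import numFieldNormedType.Exports.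

(** The basis is indexed by the finite members F of the adequate family A.
    Its vectors are the indicators [x_F = cylinder F] of the clopen sets
    {B | F is a subset of B}. If delta_G denotes evaluation at a finite
    member G, then delta_G (x_F) is 1 or 0 according to whether F is a
    subset of G. Moebius inversion over the Boolean lattice of subsets
    inverts this incidence matrix: the functionals
    [phi_F = mobius_eval F], the sums over the subsets G of F of
    (-1)^|F \ G| delta_G, are biorthogonal to the x_F
    ([mobius_eval_cylinder]), and conversely every delta_G is the sum of the
    phi_F with F a subset of G, so the phi_F and the delta_G have the same
    span ([lspan_fin_eval]).

    Everything else follows from one approximation result,
    [trace_approx]: since A is hereditary, B maps to B :&: F, for F
    finite, inside the compact space, and for u continuous the functions
    u(B :&: F) converge to u(B) uniformly in B as F grows, by compactness.
    - By Moebius inversion u(B :&: F) is the value at B of the finite sum of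
      the phi_G(u) x_G over the subsets G of F ([fin_eval_trace]), so
      the x_F span a dense subspace.
    - The evaluations at finite members have norm at most 1, lie in the span
      of the phi_F, and recover the supremum norm of u because B :&: F is
      finite: the system is 1-norming.
    - In particular the phi_F are jointly injective. Their span is then weak
      star dense by pure linear algebra: on finitely many vectors, any
      functional agrees with an element of a separating subspace of the dual
      ([total_interpolation]). *)

Local Open Scope classical_set_scope.
Local Open Scope ring_scope.

#[local] Existing Instance totally_filter.

(** * Moebius inversion over finite sets *)

Section mobius.
Local Open Scope fset_scope.
Local Open Scope ring_scope.
Context (T : choiceType) (K : pzRingType) (V : lmodType K).
Implicit Types (f g : {fset T} -> V) (F G : {fset T}).

Definition zeta f F := \sum_(G <- fpowerset F) f G.

(** The sign is that of the cardinal of F minus G, whose parity is also that of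
    the sum of the two cardinals; the sum obeys simpler recursion rules. *)
Definition mobius f F :=
  \sum_(G <- fpowerset F) (-1) ^+ (#|` F| + #|` G|) *: f G.

(** Subsets of F with one more point a either avoid a or contain it; this
    splitting drives all the inductions on finite sets below. *)
Lemma perm_fpowersetU1 (a : T) F : a \notin F ->
  perm_eq (fpowerset (a |` F))
    (fpowerset F ++ [seq a |` G | G <- fpowerset F]).
Proof.
move=> aF; have aG G : G \in fpowerset F -> a \notin G.
  by rewrite fpowersetE => /fsubsetP GF; apply: contra aF; exact: GF.
apply: uniq_perm => [||G]; first exact: fset_uniq.
  rewrite cat_uniq fset_uniq map_inj_in_uniq ?fset_uniq ?andbT /=; last first.
    by move=> G H /aG aG' /aG aH E; rewrite -(fsetU1K aG') E fsetU1K.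
  by apply/hasPn => _ /mapP[G _ ->]; apply/negP => /aG; rewrite fset1U1.
rewrite mem_cat !fpowersetE; apply/idP/orP => [GF|].
  have [aG'|aG'] := boolP (a \in G); [right|left].
    apply/mapP; exists (G `\ a); rewrite ?fsetD1K//.
    by rewrite fpowersetE fsubDset.
  by rewrite -(mem_fsetD1 aG') fsubDset.
move=> [GF|/mapP[H]]; first exact: fsubset_trans GF (fsubsetUr _ _).
by rewrite fpowersetE => HF ->; exact: fsetUS.
Qed.

Lemma sum_fpowersetU1 (a : T) F f : a \notin F ->
  \sum_(G <- fpowerset (a |` F)) f G =
  \sum_(G <- fpowerset F) f G + \sum_(G <- fpowerset F) f (a |` G).
Proof.
by move=> aF; rewrite (perm_big _ (perm_fpowersetU1 aF)) big_cat big_map.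
Qed.

Lemma eq_mobius f g F : (forall G, G `<=` F -> f G = g G) ->
  mobius f F = mobius g F.
Proof.
by move=> fg; apply: eq_big_seq => G; rewrite fpowersetE => /fg ->.
Qed.

Lemma mobiusU1 (a : T) F f : a \notin F ->
  mobius f (a |` F) = - mobius f F + mobius (fun G => f (a |` G)) F.
Proof.
move=> aF; rewrite /mobius sum_fpowersetU1// -sumrN; congr (_ + _).
  by apply: eq_bigr => G _; rewrite cardfsU1 aF addSn exprS mulN1r scaleNr.
apply: eq_big_seq => G; rewrite fpowersetE => /fsubsetP GF.
have aG : a \notin G by apply: contra aF; exact: GF.
by rewrite !cardfsU1 aF aG addSn addnS !exprS mulrA mulrNN mulr1 mul1r.
Qed.

(** By induction on F, for all f at once: adding a point a, the terms
    [- mobius f G] and [mobius f G] coming from the subsets with and without a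
    cancel, and what remains is the case of F for the shifted function. *)
Lemma mobiusK f F : zeta (mobius f) F = f F.
Proof.
elim/fset1U_rect: F f => [|a F aF IH] f.
  rewrite /zeta fpowerset0 big_seq_fset1 /mobius fpowerset0 big_seq_fset1.
  by rewrite cardfs0 scale1r.
rewrite /zeta sum_fpowersetU1// -/(zeta _ F) -big_split /=.
rewrite -[RHS](IH (fun G => f (a |` G))).
apply: eq_big_seq => G; rewrite fpowersetE => /fsubsetP GF.
have aG : a \notin G by apply: contra aF; exact: GF.
by rewrite mobiusU1// addrA subrr add0r.
Qed.

Lemma zetaK f F : mobius (zeta f) F = f F.
Proof.
elim/fset1U_rect: F f => [|a F aF IH] f.
  rewrite /mobius fpowerset0 big_seq_fset1 cardfs0 scale1r.
  by rewrite /zeta fpowerset0 big_seq_fset1.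
rewrite mobiusU1// -[RHS](IH (fun G => f (a |` G))).
apply/eqP; rewrite addrC subr_eq; apply/eqP.
rewrite /mobius -big_split /=; apply: eq_big_seq => G.
rewrite fpowersetE => /fsubsetP GF.
have aG : a \notin G by apply: contra aF; exact: GF.
by rewrite /zeta sum_fpowersetU1// addrC scalerDr.
Qed.

End mobius.

(** The indicator of the sets containing H is the zeta transform of the Dirac
    function at H. This identity is the biorthogonality of the basis. *)
Lemma mobius_indicator (T : choiceType) (K : pzRingType) (H F : {fset T}) :
  mobius (fun G => (H `<=` G)%fset%:R : K^o) F = (F == H)%:R.
Proof.
rewrite -[RHS](zetaK (fun G : {fset T} => (G == H)%:R : K^o)).
apply: eq_mobius => G _; rewrite /zeta.
have [HG|HG] := boolP (H `<=` G)%fset.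
  rewrite (big_fsetD1 H) ?fpowersetE//= eqxx big_seq big1 ?addr0// => G'.
  by rewrite !inE => /andP[/negPf ->].
rewrite big_seq big1// => G'; rewrite fpowersetE => G'G.
by case: eqP => // E; rewrite -E G'G in HG.
Qed.

(** * Linear spans *)

Section lspan_theory.
Context (K : pzRingType) (V : lmodType K) (I : Type) (v : I -> V).

Lemma lspan_gen i : lspan v (v i).
Proof.
exists 1%N, (fun=> 1), (fun=> i).
by rewrite big_ord1 scale1r.
Qed.

Lemma lspan0 : lspan v 0.
Proof.
have abs (i : 'I_0) (X : Type) : X by case: i.
by exists 0%N, (fun i => abs i K), (fun i => abs i I); rewrite big_ord0.
Qed.

Lemma lspanZ c u : lspan v u -> lspan v (c *: u).
Proof.
move=> [n [a [i ->]]]; exists n, (fun j => c * a j), i.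
by rewrite scaler_sumr; apply: eq_bigr => j _; rewrite scalerA.
Qed.

Lemma lspanD u w : lspan v u -> lspan v w -> lspan v (u + w).
Proof.
move=> [n [a [i ->]]] [m [b [j ->]]].
exists (n + m)%N,
  (fun l => match fintype.split l with inl p => a p | inr q => b q end),
  (fun l => match fintype.split l with inl p => i p | inr q => j q end).
rewrite big_split_ord /=; congr (_ + _); apply: eq_bigr => l _.
  by rewrite (unsplitK (inl l)).
by rewrite (unsplitK (inr l)).
Qed.

Lemma lspan_sum (J : eqType) (r : seq J) (f : J -> V) :
  (forall j, j \in r -> lspan v (f j)) -> lspan v (\sum_(j <- r) f j).
Proof.
move=> vf; rewrite big_seq; elim/big_ind: _ => //; first exact: lspan0.
exact: lspanD.
Qed.

End lspan_theory.

(** * Separating subspaces of the dual *)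

Section dual_theory.
Context (K : numFieldType) (X : normedModType K).
Implicit Types (phi psi : dual X) (u v : X).

Lemma dual_linear phi : linear phi.
Proof. by case: phi => f /= /set_mem[]. Qed.

Lemma dual_continuous phi : continuous phi.
Proof. by case: phi => f /= /set_mem[]. Qed.

Lemma dualD phi psi u : (phi + psi) u = phi u + psi u.
Proof. by []. Qed.

Lemma dualZ a phi u : (a *: phi) u = a * phi u.
Proof. by []. Qed.

Lemma dual0 u : (0 : dual X) u = 0.
Proof. by []. Qed.

Lemma dualN phi u : (- phi) u = - phi u.
Proof. by []. Qed.

Lemma dual_map0 phi : phi 0 = 0 :> K.
Proof.
by have := dual_linear phi (-1) 0 0; rewrite scaler0 addr0 scaleN1r addNr.
Qed.

Lemma dual_mapD phi u v : phi (u + v) = phi u + phi v.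
Proof. by have := dual_linear phi 1 u v; rewrite !scale1r. Qed.

Lemma dual_mapZ phi a u : phi (a *: u) = a * phi u.
Proof. by have := dual_linear phi a u 0; rewrite dual_map0 !addr0. Qed.

Lemma dual_mapB phi u v : phi (u - v) = phi u - phi v.
Proof. by rewrite -scaleN1r dual_mapD dual_mapZ mulN1r. Qed.

Lemma dual_sum (I : Type) (r : seq I) (F : I -> dual X) u :
  (\sum_(i <- r) F i) u = \sum_(i <- r) F i u.
Proof. by elim/big_rec2: _ => // i a phi _ <-. Qed.

Lemma dual_bounded phi : exists2 M, 0 <= M & forall u, `|phi u| <= M * `|u|.
Proof.
pose lphi := GRing.isLinear.Build K X K^o *:%R phi (dual_linear phi).
pose f : {linear X -> K^o} := HB.pack (dual_fun phi) lphi.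
have /linear_bounded_continuous/linear_boundedP[r [rreal fr]] : continuous f.
  exact: dual_continuous.
have r1 : r < `|r| + 1 by rewrite ltr_pwDr// real_ler_norm.
by exists (`|r| + 1); [rewrite addr_ge0|move=> u; exact: fr].
Qed.

Definition submod_set (L : set (dual X)) : Prop :=
  L 0 /\ forall a phi psi, L phi -> L psi -> L (a *: phi + psi).

(** Restricted to L, the evaluation at u vanishes on the common kernel of the
    evaluations at us, hence is a combination of them, and w is that combination
    of vectors. The first property of w is all that is used of its being in the
    span of us, and avoids mentioning coefficients. In the induction the
    subspace shrinks to the kernel L' of the evaluation at the first vector v:
    on L, the difference u - w' kills the kernel of v, so it is a multiple
    of v. *)
Lemma factor_through_evaluations (L : set (dual X)) (us : seq X) (u : X) :
  submod_set L ->
  (forall phi, L phi ->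
    (forall v, v \in us -> phi v = 0 :> K) -> phi u = 0 :> K) ->
  exists2 w,
    (forall phi, (forall v, v \in us -> phi v = 0 :> K) -> phi w = 0 :> K) &
    forall phi, L phi -> phi u = phi w.
Proof.
elim: us u L => [|v us IH] u L [L0 LZD] Lu.
  by exists 0 => [phi _|phi /Lu ->//]; rewrite dual_map0.
pose L' := [set phi | L phi /\ phi v = 0 :> K].
have [||w' usw' Lw'] := IH u L'.
- split=> [|a phi psi [Lphi phiv] [Lpsi psiv]]; first by [].
  by split; [exact: LZD|rewrite dualD dualZ phiv psiv mulr0 addr0].
- move=> phi [Lphi phiv] phius; apply: Lu => // z.
  by rewrite in_cons => /predU1P[->//|]; exact: phius.
have [[phi0 [Lphi0 phi0v]]|Lv] :=
    pselect (exists phi, L phi /\ phi v != 0 :> K); last first.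
  exists w' => [phi phius|phi Lphi].
    by apply: usw' => z zus; apply: phius; rewrite in_cons zus orbT.
  apply: Lw'; split=> //; apply: contrapT => /eqP phiv.
  by apply: Lv; exists phi.
(* The only possible factor: test u - w' = c *: v against phi0. *)
pose c := (phi0 u - phi0 w') / phi0 v.
exists (w' + c *: v) => [phi phius|phi Lphi].
  rewrite dual_mapD dual_mapZ (phius v) ?mem_head// mulr0 addr0.
  by apply: usw' => z zus; apply: phius; rewrite in_cons zus orbT.
have : ((- (phi v / phi0 v)) *: phi0 + phi) u =
       ((- (phi v / phi0 v)) *: phi0 + phi) w'.
  apply: Lw'; split; first exact: LZD.
  by rewrite dualD dualZ mulNr divfK// addNr.
rewrite !dualD !dualZ dual_mapD dual_mapZ /c => E.
by apply: (addrI (- (phi v / phi0 v) * phi0 u)); rewrite E; field.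
Qed.

(** By induction on us. If some g in L vanishes on us but not on u, a multiple
    of g corrects the value at u. Otherwise u has, for L, the same values as a
    vector w in the span of us; as L separates points, u = w, and agreement on
    us already gives agreement at u. *)
Lemma total_interpolation (L : set (dual X)) (psi : dual X) (us : seq X) :
  submod_set L ->
  (forall u, (forall phi, L phi -> phi u = 0 :> K) -> u = 0) ->
  exists2 phi, L phi & forall u, u \in us -> phi u = psi u.
Proof.
move=> [L0 LZD] Ltot; elim: us => [|u us [phi Lphi phius]]; first by exists 0.
have [[g [Lg gus gu]]|nog] := pselect
    (exists g, [/\ L g, forall v, v \in us -> g v = 0 :> K & g u != 0 :> K]).
  exists ((psi u - phi u) / g u *: g + phi); first exact: LZD.
  move=> v; rewrite in_cons dualD dualZ => /predU1P[->|vus].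
    by rewrite divfK// subrK.
  by rewrite (gus v)// mulr0 add0r phius.
have [||w usw Lw] := @factor_through_evaluations L us u.
- by split.
- move=> g Lg gus; apply: contrapT => /eqP gu.
  by apply: nog; exists g.
have -> : u = w.
  apply/eqP; rewrite -subr_eq0; apply/eqP; apply: Ltot => g Lg.
  by rewrite dual_mapB Lw// subrr.
exists phi => // v; rewrite in_cons => /predU1P[->|]; last exact: phius.
apply/eqP; rewrite -subr_eq0 -dualN -dualD; apply/eqP; apply: usw => z zus.
by rewrite dualD dualN phius// subrr.
Qed.

End dual_theory.

Lemma cvg_initial (S : choiceType) (T : topologicalType) (f : S -> T)
    (F : set_system S) (s : S) : Filter F ->
  f @ F --> f s -> F --> (s : initial_topology f).
Proof.
move=> FF fF U [_ [[W oW <-] Ws] WU]; apply: filterS WU _.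
by apply: fF; exact: open_nbhs_nbhs.
Qed.

Lemma cvg_ptws (U : Type) (V : topologicalType) (F : set_system (U -> V))
    (f : U -> V) : Filter F ->
  (forall x, (fun g => g x) @ F --> f x) -> F --> (f : {ptws U -> V}).
Proof. by move=> FF Ff; apply/cvg_sup => x; apply: cvg_initial; exact: Ff. Qed.

(** A weak star neighbourhood only constrains finitely many values, so the
    functionals c us in the span, chosen to agree with psi on the finite
    set us, converge to psi as us grows. *)
Lemma total_weak_star_dense (K : numFieldType) (X : normedModType K)
    (I : Type) (v : I -> dual X) :
  (forall u, (forall i, v i u = 0 :> K) -> u = 0) ->
  dense (lspan v : set (weak_star X)).
Proof.
move=> vtot O [psi Opsi] oO.
have subL : submod_set (lspan v).
  split=> [|a f g Lf Lg]; first exact: lspan0.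
  by apply: lspanD => //; exact: lspanZ.
have Ltot u : (forall phi, lspan v phi -> phi u = 0 :> K) -> u = 0.
  by move=> Lu; apply: vtot => i; exact/Lu/(lspan_gen v).
have /choice[c cP] (us : {fset X}) : exists phi,
    lspan v phi /\ forall u, u \in us -> phi u = psi u.
  have [phi ? ?] := total_interpolation psi (enum_fset us) subL Ltot.
  by exists phi.
have cpt : (@dual_fun K X \o c) @ totally --> (dual_fun psi : {ptws X -> K^o}).
  apply: cvg_ptws => u W Wpsi.
  exists [fset u]%fset => // us /= usu; rewrite /= (cP us).2.
    exact: nbhs_singleton.
  by apply: (fsubsetP usu); rewrite in_fset1.
have cpsi : c @ totally --> (psi : weak_star X).
  by apply: cvg_initial; exact: cpt.
have [us] : exists us, O (c us).
  have : totally (c @^-1` O) by apply: cpsi; exact: open_nbhs_nbhs.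
  exact: filter_ex.
by exists (c us); split=> //; exact: (cP us).1.
Qed.

(** * The dual norm over the real or complex scalars *)

Lemma contraction_dual_pred (K : numFieldType) (X : normedModType K)
    (f : X -> K^o) :
  linear f -> (forall u, `|f u| <= `|u|) -> f \in @dual_pred K X.
Proof.
move=> lf f1; apply/mem_set; split=> // u.
apply/cvgrPdist_le => e e0; near=> v.
have -> : f u - f v = f (u - v).
  by rewrite [u - v]addrC -[- v]scaleN1r lf scaleN1r addrC.
by apply: le_trans (f1 _) _; near: v; exact: cvgr_dist_le.
Unshelve. all: by end_near. Qed.

Section dual_norm_theory.
Context (R : realType) (k : scalar_kind).
Local Notation K := (scalar_field R k).
Context (X : normedModType K).
Implicit Types (phi : dual X) (u : X).

Lemma dual_norm_supremums phi :
  supremums [set `|phi u| | u in [set u | `|u| <= 1]] (dual_norm phi).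
Proof.
apply: scalar_supremums => [_ [u _ <-]//|]; split.
  by exists `|phi 0|, 0 => //=; rewrite normr0 ler01.
have [M M0 phiM] := dual_bounded phi.
exists M => _ [u /= u1 <-]; apply: le_trans (phiM u) _.
by rewrite -[leRHS]mulr1 ler_wpM2l.
Qed.

Lemma dual_norm_le phi (M : K) :
  (forall u, `|u| <= 1 -> `|phi u| <= M) -> dual_norm phi <= M.
Proof.
move=> phiM; have [_ +] := dual_norm_supremums phi; apply=> _ [u u1 <-].
exact: phiM.
Qed.

Lemma le_dual_norm1 phi u : dual_norm phi <= 1 -> `|phi u| <= `|u|.
Proof.
move=> phi1; have [->|u0] := eqVneq u 0; first by rewrite dual_map0 !normr0.
have [+ _] := dual_norm_supremums phi.
move=> /(_ `|phi (`|u|^-1 *: u)|) /= le.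
have {le} : `|phi (`|u|^-1 *: u)| <= dual_norm phi.
  apply: le; exists (`|u|^-1 *: u) => //=.
  by rewrite normrZ normfV normr_id mulVf// normr_eq0.
move=> /le_trans/(_ phi1); rewrite dual_mapZ normrM normfV normr_id.
by rewrite ler_pdivrMl ?normr_gt0// mulr1.
Qed.

(** The supremum is a genuine one, not its default value, because functionals
    of norm at most 1 are bounded at u by the norm of u. *)
Lemma norming_supremum (L : set (dual X)) u phi :
  L phi -> dual_norm phi <= 1 ->
  `|phi u| <= supremum 0
    [set `|psi u| | psi in L `&` [set psi | dual_norm psi <= 1]].
Proof.
move=> Lphi phi1; set E := (E in supremum 0 E).
have Ephi : E `|phi u| by exists phi.
have [ubE _] : supremums E (supremum 0 E).
  apply: scalar_supremums => [_ [psi _ <-]//|].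
  split; first by exists `|phi u|.
  by exists `|u| => _ [psi [_ /= psi1] <-]; exact: le_dual_norm1.
exact: ubE.
Qed.

End dual_norm_theory.

(** * Evaluation functionals *)

Section evaluation.
Context (R : realType) (k : scalar_kind) (X : compactSpaceType).
Local Notation K := (scalar_field R k).
Local Notation C := (cfun R k X).

Definition eval_fun (p : X) (u : C) : K^o := u p.

Lemma eval_dual_pred (p : X) : eval_fun p \in @dual_pred K C.
Proof.
by apply: contraction_dual_pred => [a u v//|u]; exact: le_sup_norm.
Qed.

Definition eval_dual (p : X) : dual C := Dual (eval_dual_pred p).

Lemma eval_dual_norm (p : X) : dual_norm (eval_dual p) <= 1.
Proof.
by apply: dual_norm_le => u; exact: le_trans (le_sup_norm u p).
Qed.

End evaluation.

(** * Continuous functions on an adequate compact *)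

Section adequate_cfun.
Context (R : realType) (k : scalar_kind) (S : Type) (A : set (set S)).
Context (hA : adequate A).
Local Notation K := (scalar_field R k).
Local Notation T := {classic S}.
Local Notation KA := (adequate_compact hA).
Local Notation C := (cfun R k KA).

Definition in_pt (B : KA) : T -> bool := set_val B.

Lemma in_ptP (B : KA) : A [set x | in_pt B x].
Proof. exact: (set_valP B). Qed.

Lemma indic_pt_subproof (B : set S) (AB : A B) :
  (fun x : S => `[< B x >]) \in adequate_indic A.
Proof.
apply/mem_set; rewrite /adequate_indic /=; apply: (adequateS hA AB).
by move=> x /= /asboolP.
Qed.

Definition indic_pt (B : set S) (AB : A B) : KA :=
  SigSub (indic_pt_subproof AB).

Lemma in_indic_pt (B : set S) (AB : A B) (x : T) :
  in_pt (indic_pt AB) x = `[< B x >].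
Proof. by []. Qed.

(** The value 0 outside the family makes [fin_eval] total on finite sets, so
    that Moebius inversion applies to it; as subsets of members are members,
    this value does not occur in the sums over subsets of a member. *)
Definition fin_eval (G : {fset T}) : dual C :=
  if pselect (A [set` G]) is left AG then eval_dual R k (indic_pt AG) else 0.

Lemma in_pt_continuous (x : T) :
  continuous (fun B : KA => in_pt B x : bool).
Proof.
move=> B.
apply: (@continuous_comp KA {ptws S -> bool} bool set_val (fun f => f x)).
  exact: initial_continuous.
exact: (@proj_continuous T (fun=> bool) x).
Qed.

Lemma near_agree (F : seq T) (B : KA) :
  \forall B' \near B, {in F, in_pt B' =1 in_pt B}.
Proof.
elim: F => [|x F IH]; first by apply: filterE => B' x.
have xB : \forall B' \near B, in_pt B' x = in_pt B x.
  have bB : nbhs (in_pt B x) [set b | b = in_pt B x].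
    exact/principal_filterP.
  exact: (in_pt_continuous bB).
apply: filterS2 xB IH => B' xB' FB' y; rewrite in_cons => /predU1P[->//|].
exact: FB'.
Qed.

Definition cylinder_indicator (F : {fset T}) (B : KA) : K^o :=
  (all (in_pt B) F)%:R.

Lemma cylinder_continuous F : cylinder_indicator F \in @cts_pred R k KA.
Proof.
apply/mem_set => B.
apply: (@cvg_near_cst KA K^o (cylinder_indicator F B) _ (nbhs B)).
near=> B'; rewrite /cylinder_indicator (@eq_in_all _ _ (in_pt B))//.
by near: B'; exact: near_agree.
Unshelve. all: by end_near. Qed.

Definition cylinder (F : {fset T}) : C := cfun_Sub (cylinder_continuous F).

Definition trace (F : {fset T}) (B : KA) : {fset T} :=
  [fset x in F | in_pt B x]%fset.

Lemma trace_in F B : A [set` trace F B].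
Proof.
apply: (adequateS hA (in_ptP B)) => x /=.
by rewrite !inE /= => /andP[].
Qed.

Definition trunc (F : {fset T}) (B : KA) : KA := indic_pt (trace_in F B).

Lemma in_trunc F B x : in_pt (trunc F B) x = (x \in F) && in_pt B x.
Proof. by rewrite in_indic_pt asboolb !inE. Qed.

(** Membership of a given x in the trace of B' on F is that of x in B as soon
    as F contains x and B' agrees with B at x. The convergence is joint in B'
    and F, as the compactness argument requires. *)
Lemma trunc_cvg (B : KA) :
  (fun p : KA * {fset T} => trunc p.2 p.1) @ filter_prod (nbhs B) totally --> B.
Proof.
apply: cvg_initial; apply: cvg_ptws => x W WB.
have near_x : filter_prod (nbhs B) totally
    [set p : KA * {fset T} | in_pt (trunc p.2 p.1) x = in_pt B x].
  exists ([set B' | in_pt B' x = in_pt B x], [set F : {fset T} | x \in F]).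
    split; last first.
      by exists [fset (x : T)]%fset => //= F /fsubsetP; apply; rewrite in_fset1.
    apply: filterS (near_agree [:: x] B) => B' /(_ x).
    by apply; rewrite mem_head.
  by move=> [B' F] [/= xB xF]; rewrite in_trunc xF.
apply: filterS near_x => p /= px.
have -> : set_val (trunc p.2 p.1) x = set_val B x by exact: px.
exact: nbhs_singleton.
Qed.

Lemma fin_evalE (G : {fset T}) (AG : A [set` G]) (u : C) :
  fin_eval G u = u (indic_pt AG).
Proof.
rewrite /fin_eval; case: pselect => // AG'.
by rewrite /= /eval_fun (Prop_irrelevance AG AG').
Qed.

(** Pointwise, u (trunc F B') and u B' both tend to u B as B' tends to B and F
    grows; compactness, in its near-covering form, makes F uniform in B. *)
Lemma trace_approx (u : C) (e : K) : 0 < e ->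
  exists F, forall B, `|u B - fin_eval (trace F B) u| <= e.
Proof.
move=> e0.
suff : \forall F \near totally, forall B, [set: KA] B ->
    `|u B - u (trunc F B)| <= e.
  move=> /filter_ex[F uF]; exists F => B; rewrite (fin_evalE (trace_in F B)).
  exact: uF.
have /compact_near_coveringP := @compact_space KA.
apply => B _.
have uB : {for B, continuous (u : KA -> K^o)} by exact: cts_fun.
have ucvg (h : KA * {fset T} -> KA) : h @ filter_prod (nbhs B) totally --> B ->
    (fun p => u (h p) : K^o) @ filter_prod (nbhs B) totally --> (u B : K^o).
  by move=> hB; apply: (@cvg_comp _ _ _ h (u : KA -> K^o) _ (nbhs B)).
have diff0 : (fun p => u p.1 - u (trunc p.2 p.1) : K^o) @
    filter_prod (nbhs B) totally --> (0 : K^o).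
  by rewrite -(subrr (u B : K^o)); apply: cvgB; apply: ucvg;
    [exact: cvg_fst|exact: trunc_cvg].
move: diff0 => /cvgr0Pnorm_le/(_ e e0).
by apply: filterS => -[].
Qed.

Lemma fin_eval_cylinder (G H : {fset T}) : A [set` G] ->
  fin_eval G (cylinder H) = (H `<=` G)%fset%:R.
Proof.
move=> AG; rewrite (fin_evalE AG) /= /cylinder_indicator.
congr (nat_of_bool _)%:R.
apply/allP/fsubsetP => HG x /HG; rewrite in_indic_pt; first by move/asboolP.
by move=> xG; apply/asboolP.
Qed.

Definition mobius_eval (F : {fset T}) : dual C := mobius fin_eval F.

Lemma mobius_eval_cylinder (F H : {fset T}) : A [set` F] ->
  mobius_eval F (cylinder H) = (F == H)%:R.
Proof.
move=> AF; rewrite -mobius_indicator /mobius_eval /mobius dual_sum.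
apply: eq_big_seq => G; rewrite fpowersetE => /fsubsetP GF.
rewrite dualZ fin_eval_cylinder//; exact: (adequateS hA AF).
Qed.

(** The evaluation at the trace is the sum of the [mobius_eval G] over the
    subsets G of the trace, and these are the subsets G of F with [cylinder G]
    equal to 1 at B. *)
Lemma fin_eval_trace F (B : KA) (u : C) :
  fin_eval (trace F B) u =
  (\sum_(G <- fpowerset F) mobius_eval G u *: cylinder G) B.
Proof.
have -> : (\sum_(G <- fpowerset F) mobius_eval G u *: cylinder G) B =
          \sum_(G <- fpowerset F) mobius_eval G u * (all (in_pt B) G)%:R.
  by elim/big_rec2: _ => // G _ f _ <-.
rewrite -(mobiusK fin_eval) dual_sum.
rewrite -(@big_fset_incl _ _ _ _ (fpowerset (trace F B)) (fpowerset F)).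
- apply: eq_big_seq => G; rewrite fpowersetE => /fsubsetP GF.
  have -> : all (in_pt B) G by apply/allP => x /GF; rewrite !inE => /andP[].
  by rewrite mulr1.
- by rewrite fpowersetS; apply/fsubsetP => x; rewrite !inE => /andP[].
move=> G; rewrite !fpowersetE => /fsubsetP GF GB.
have [/allP BG|_] := boolP (all (in_pt B) G); last by rewrite mulr0.
case/negP: GB; apply/fsubsetP => x xG; rewrite !inE /=.
by apply/andP; split; [exact: GF|exact: BG].
Qed.

Definition fin_member : choiceType :=
  {F : {fset T} | `[< A [set` F] >]}.

Lemma cylinder_out (G : {fset T}) : ~ A [set` G] -> cylinder G = 0.
Proof.
move=> nAG; apply/continuousEP => B.
rewrite -[LHS]/((all (in_pt B) G)%:R : K^o).
have [/allP BG|//] := boolP (all (in_pt B) G).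
by case: nAG; apply: (adequateS hA (in_ptP B)) => x /= /BG.
Qed.

Let x (F : fin_member) := cylinder (val F).
Let phi (F : fin_member) := mobius_eval (val F).

Lemma lspan_cylinder G : lspan x (cylinder G).
Proof.
have [AG|nAG] := pselect (A [set` G]); last first.
  by rewrite cylinder_out//; exact: lspan0.
exact: (lspan_gen x (exist _ G (asboolT AG))).
Qed.

Lemma lspan_fin_eval G : lspan phi (fin_eval G).
Proof.
have [AG|nAG] := pselect (A [set` G]); last first.
  by rewrite /fin_eval; case: pselect => // _; exact: lspan0.
rewrite -(mobiusK fin_eval); apply: lspan_sum => H.
rewrite fpowersetE => /fsubsetP HG.
have AH : A [set` H] by exact: (adequateS hA AG).
exact: (lspan_gen phi (exist _ H (asboolT AH))).
Qed.

Lemma lspan_cylinder_dense : dense (lspan x).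
Proof.
move=> O [u Ou] oO.
have /nbhs_ballP[e /= e0 uO] : nbhs u O by exact: open_nbhs_nbhs.
have [F uF] := trace_approx u (divr_gt0 e0 (ltr0Sn K 1)).
exists (\sum_(G <- fpowerset F) mobius_eval G u *: cylinder G); split.
  apply: uO; rewrite -ball_normE /=.
  apply: (@le_lt_trans _ _ (e / 2)); last first.
    by rewrite ltr_pdivrMr ?ltr_pMr ?ltr1n.
  apply: sup_norm_le => [|B]; first by rewrite ltW// divr_gt0.
  by have := uF B; rewrite fin_eval_trace.
by apply: lspan_sum => G _; apply: lspanZ; exact: lspan_cylinder.
Qed.

Lemma mobius_eval_total (u : C) : (forall F, phi F u = 0 :> K) -> u = 0.
Proof.
move=> u0; have uG G : fin_eval G u = 0 :> K.
  have [n [a [i ->]]] := lspan_fin_eval G.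
  by rewrite dual_sum big1// => j _; rewrite dualZ u0 mulr0.
apply/continuousEP => B; apply/eqP; rewrite -normr_le0.
apply/ler_addgt0Pl => e e0.
have [F uF] := trace_approx u e0.
by have := uF B; rewrite uG subr0 addr0.
Qed.

(** Each evaluation at a finite member competes in the supremum, so u is bounded
    by it at all traces, hence everywhere by approximation. *)
Lemma mobius_eval_one_norming : one_norming phi.
Proof.
move=> u; set s := supremum _ _.
have us G : `|fin_eval G u| <= s.
  apply: norming_supremum; first exact: lspan_fin_eval.
  rewrite /fin_eval; case: pselect => [AG|_]; first exact: eval_dual_norm.
  by apply: dual_norm_le => v _; rewrite dual0 normr0.
apply: sup_norm_le => [|B]; first exact: le_trans (us fset0).
apply/ler_addgt0Pl => e e0; have [F uF] := trace_approx u e0.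
rewrite -[u B](subrK (fin_eval (trace F B) u)).
exact: le_trans (ler_normD _ _) (lerD (uF B) (us _)).
Qed.

Lemma markushevich_cylinder : markushevich_basis x phi.
Proof.
split.
- by move=> F H; rewrite mobius_eval_cylinder//; exact/asboolP/(valP F).
- exact: lspan_cylinder_dense.
- exact: total_weak_star_dense mobius_eval_total.
Qed.
End adequate_cfun.

Theorem theorem5p1 (R : realType) (k : scalar_kind) (S : Type)
    (A : set (set S)) (hA : adequate A) :
  exists (Gamma : choiceType) (x : Gamma -> cfun R k (adequate_compact hA))
         (phi : Gamma -> dual (cfun R k (adequate_compact hA))),
    markushevich_basis x phi /\ one_norming phi.
Proof.
exists (fin_member A), (fun F => cylinder R k hA (val F)),
  (fun F => mobius_eval R k hA (val F)).
by split; [exact: markushevich_cylinder|exact: mobius_eval_one_norming].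
Qed.
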